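(* Let $p$ be a prime and let $r$ be a positive integer with $p^r>2$. Then for $|x|<1$, $$\sum_{n=1}^{\infty}Q_{p^r}(n)x^n=\frac{x^{p^r}}{(1-x^2)\left(1-x^{2(p^r-1)} \right) }-\frac{x^{p^r}}{1-x^{2p^r}}.$$
   Context: For positive integers $n,k$, $Q_k(n)$ denotes the number of tuples $(t_1,t_2,\ldots,t_{\lceil n/2\rceil})$ of nonnegative integers with $\sum_{i=1}^{\lceil n/2\rceil}(2i-1)t_i=n$ (i.e. partitions of $n$ into odd parts, where $t_i$ is the multiplicity of the part $2i-1$) such that the multinomial coefficient $\binom{t_1+\cdots+t_{\lceil n/2\rceil}}{t_1,\ldots,t_{\lceil n/2\rceil}}=\frac{(t_1+\cdots+t_{\lceil n/2\rceil})!}{t_1!\cdots t_{\lceil n/2\rceil}!}$ equals $k$. *)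

(* Defs.v *)
From mathcomp Require Export all_boot all_order all_algebra.
From mathcomp Require Export finmap.
From mathcomp Require Export all_classical all_reals all_analysis.
From mathcomp Require Export complex.

Set Implicit Arguments.
Unset Strict Implicit.
Unset Printing Implicit Defensive.

Import Order.TTheory GRing.Theory Num.Theory.
Export numFieldNormedType.Exports.

Local Open Scope nat_scope.
Local Open Scope classical_set_scope.

Definition multinomial (m : nat) (t : {ffun 'I_m -> nat}) : nat :=
  (\sum_i t i)`! %/ \prod_i (t i)`!.

(* The truncated division in [multinomial] is exact. *)
Lemma multinomial_dvd (m : nat) (t : {ffun 'I_m -> nat}) :
  \prod_i (t i)`! %| (\sum_i t i)`!.
Proof.
apply: (big_ind2 (fun P s => P %| s`!)) => // P1 s1 P2 s2 h1 h2.
apply: dvdn_trans (dvdn_mul h1 h2) _.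
by rewrite -(bin_fact (leq_addr s2 s1)) addKn dvdn_mull.
Qed.

(* The index [i : 'I_(uphalf n)] starts at 0, so the part with multiplicity
   [t i] is [2 * i + 1]; [uphalf n] is the ceiling of [n / 2]. *)
Definition odd_partitions_multinomial (k n : nat) :
    set {ffun 'I_(uphalf n) -> nat} :=
  [set t : {ffun 'I_(uphalf n) -> nat} |
    \sum_(i < uphalf n) (2 * i + 1) * t i = n /\ multinomial t = k].

Arguments odd_partitions_multinomial : clear implicits.

Definition Q (k n : nat) : nat :=
  #|` fset_set (odd_partitions_multinomial k n)|%fset.

(* [fset_set] is the empty set on infinite sets; this case does not occur. *)
Lemma finite_odd_partitions_multinomial (k n : nat) :
  finite_set (odd_partitions_multinomial k n).
Proof.
pose f (u : {ffun 'I_(uphalf n) -> 'I_n.+1}) := [ffun i => u i : nat].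
apply: (@sub_finite_set _ _ (range f)); last first.
  by apply: finite_image; exact: finite_finset.
move=> t [tn _]; exists [ffun i => inord (t i)] => //.
apply/ffunP => i; rewrite !ffunE inordK // ltnS -[leqRHS]tn (bigD1 i) //=.
by rewrite (leq_trans _ (leq_addr _ _)) // leq_pmull // addn1.
Qed.

(* Main.v *)
Require Import Defs.
From mathcomp Require Import all_boot all_order all_algebra.
From mathcomp Require Import all_classical all_reals all_analysis.
From mathcomp Require Import complex.
From mathcomp Require Import zify ring.

(* A prime power dividing C(n, k) is at most n, whereas C(n, k) > n when
   2 <= k <= n - 2; hence C(n, k) is a prime power only for k = 1 or k = n - 1.
   A multinomial coefficient is divisible by C(s, t_j), where s is the sum of the
   t_i, so it equals q = p^r > 2 exactly when the nonzero multiplicities are 1 and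
   q - 1.  Thus Q_q(n) counts the pairs of distinct odd parts u, v with
   u + (q - 1) v = n, and the generating function is the product of the geometric
   series for u and v minus the diagonal u = v.  On partial sums, the triangle
   u + (q - 1) v < N is compared with an N x N square, at a cost of at most
   N^2 |x|^N. *)

Set Implicit Arguments.
Unset Strict Implicit.
Unset Printing Implicit Defensive.

Import Order.TTheory GRing.Theory Num.Theory.

Local Open Scope nat_scope.

(** * Prime powers among binomial coefficients *)

Lemma big_nat_stable (T : Type) (idx : T) (op : Monoid.law idx) (l m n : nat)
    (F : nat -> T) : l <= m <= n -> (forall k, m <= k -> F k = idx) ->
  \big[op/idx]_(l <= k < m) F k = \big[op/idx]_(l <= k < n) F k.
Proof.
move=> /andP[lm mn] F0; rewrite [RHS](@big_cat_nat _ _ _ m) //=.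
rewrite [X in op _ X]big_nat [X in op _ X]big1 ?Monoid.mulm1 // => k /andP[mk _].
exact: F0.
Qed.

(** Legendre's formula with a free upper limit, so that several factorials can be compared term by
    term; the extra quotients vanish because [p ^ k] exceeds [n]. *)
Lemma logn_fact_widen (p n m : nat) : prime p -> n <= m ->
  logn p n`! = \sum_(1 <= k < m.+1) n %/ p ^ k.
Proof.
move=> pp nm; rewrite logn_fact //; apply: big_nat_stable; first by rewrite !ltnS.
by move=> k nk; rewrite divn_small // (ltn_trans nk) // ltn_expl // prime_gt1.
Qed.

(** A weak form of Kummer's theorem: the exponent of [p] counts the carries in the base [p] addition
    of [k] and [n - k], and there are at most log_p [n] of them. *)
Lemma pfactor_logn_bin_leq (p n k : nat) : prime p -> k <= n -> 0 < n ->
  p ^ logn p 'C(n, k) <= n.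
Proof.
move=> pp kn n0; have p1 := prime_gt1 pp.
apply: leq_trans (trunc_logP p1 n0); rewrite leq_exp2l //.
have := congr1 (logn p) (bin_fact kn).
rewrite !lognM ?muln_gt0 ?fact_gt0 ?bin_gt0 // => E.
(* By Legendre's formula, each [j <= log_p n] contributes a carry of at most 1. *)
rewrite -(leq_add2r (logn p k`! + logn p (n - k)`!)) E.
rewrite !(@logn_fact_widen p _ n) ?leq_subr // -big_split /=.
apply: (@leq_trans (\sum_(1 <= j < n.+1)
    ((j <= trunc_log p n) + (k %/ p ^ j + (n - k) %/ p ^ j)))).
  apply: leq_sum => j _; have pj : 0 < p ^ j by rewrite expn_gt0 ltnW.
  have [jl|jl] := leqP j (trunc_log p n).
    rewrite -{1}(subnKC kn) divnD // addnC leq_add2r; exact: leq_b1.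
  rewrite divn_small // ltnNge; apply/negP => /(trunc_log_max p1).
  by rewrite leqNgt jl.
rewrite big_split /= leq_add2r.
rewrite -[leqRHS]subn0 -[leqRHS](subSS 0) -[leqRHS]muln1 -sum_nat_const_nat.
have Tn : trunc_log p n <= n.
  by apply: ltnW; apply: leq_trans (trunc_logP p1 n0); apply: ltn_expl.
rewrite (@big_cat_nat _ _ _ (trunc_log p n).+1) //=.
rewrite [X in _ + X]big_nat [X in _ + X]big1 ?addn0
  => [|j /andP[jT _]]; last by rewrite leqNgt jT.
by apply: leq_sum => j _; exact: leq_b1.
Qed.

Lemma bin_geq (n k : nat) : 0 < k -> k < n -> n <= 'C(n, k).
Proof.
elim: n k => // n IH [|k] // _; rewrite ltnS leq_eqVlt binS => /orP[/eqP <-|kn].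
  by rewrite binn binSn.
by rewrite -addn1 leq_add ?IH // bin_gt0 ltnW // ltnW.
Qed.

(** Pascal's rule gives two coefficients of the row above, each at least [n - 1] by [bin_geq], and
    2(n - 1) > n because n >= 4. *)
Lemma bin_gtn (n k : nat) : 1 < k -> k.+1 < n -> n < 'C(n, k).
Proof.
case: n k => // n [|[|k]] // _; rewrite ltnS binS => kn.
have := @bin_geq n k.+1 isT (ltnW kn); have := @bin_geq n k.+2 isT kn.
lia.
Qed.

Lemma bin_prime_power (p e n k : nat) : prime p -> 0 < k -> k < n ->
  'C(n, k) = p ^ e -> k = 1 \/ k.+1 = n.
Proof.
move=> pp k0 kn E; have n0 : 0 < n by exact: leq_ltn_trans kn.
have := pfactor_logn_bin_leq pp (ltnW kn) n0.
rewrite E pfactorK // -E.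
have [k1|k1] := leqP k 1; first by left; lia.
have [nk|nk] := leqP n k.+1; first by right; lia.
by have := bin_gtn k1 nk; lia.
Qed.

(** * Multiplicity tuples whose multinomial coefficient is a prime power *)

Definition two_part (m q : nat) (i j : 'I_m) : {ffun 'I_m -> nat} :=
  [ffun k => if k == i then 1 else if k == j then q.-1 else 0].

(** Stated for any commutative operation so as to serve the sum of the multiplicities, the product
    of their factorials and the weighted sum of the parts. *)
Lemma big_two_part (T : Type) (idx : T) (op : Monoid.com_law idx) (m q : nat)
    (i j : 'I_m) (F : 'I_m -> nat -> T) : i != j -> (forall k, F k 0 = idx) ->
  \big[op/idx]_k F k (two_part q i j k) = op (F i 1) (F j q.-1).
Proof.
move=> ij F0; rewrite (bigD1 i) //= (bigD1 j) 1?eq_sym //= !ffunE eqxx.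
rewrite [j == i]eq_sym (negPf ij) eqxx big1 ?Monoid.mulm1 // => k /andP[ki kj].
by rewrite ffunE (negPf ki) (negPf kj).
Qed.

Lemma multinomial_two_part (m q : nat) (i j : 'I_m) : 0 < q -> i != j ->
  multinomial (two_part q i j) = q.
Proof.
move=> q0 ij; rewrite /multinomial.
rewrite (@big_two_part _ _ addn _ _ _ _ (fun _ a => a)) //.
rewrite (@big_two_part _ _ muln _ _ _ _ (fun _ a => a`!)) //.
by rewrite /= add1n prednK // mul1n -{1}(prednK q0) factS mulnK ?fact_gt0 // prednK.
Qed.

(** As [q] > 2, the multiplicities 1 and [q - 1] differ and reveal which index is which; for [q] = 2
    the pair could be swapped. *)
Lemma two_part_inj (m q : nat) (i j i' j' : 'I_m) : 2 < q -> i != j -> i' != j' ->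
  two_part q i j = two_part q i' j' -> (i, j) = (i', j').
Proof.
move=> q2 ij ij' E.
have Ei : i = i'.
  have := congr1 (fun f : {ffun _} => f i) E; rewrite !ffunE eqxx.
  by case: eqP => // _; case: eqP => // _; lia.
rewrite -Ei in ij' E *; congr (_, _).
have := congr1 (fun f : {ffun _} => f j) E; rewrite !ffunE.
rewrite [j == i]eq_sym (negPf ij) eqxx; case: eqP => // _; lia.
Qed.

Lemma dvdn_fact_sum (I : finType) (P : pred I) (t : I -> nat) :
  \prod_(i | P i) (t i)`! %| (\sum_(i | P i) t i)`!.
Proof.
apply: (big_ind2 (fun a s => a %| s`!)) => // a s b s' h h'.
apply: dvdn_trans (dvdn_mul h h') _.
by rewrite -(bin_fact (leq_addr s' s)) addKn dvdn_mull.
Qed.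

(** The cofactor [c] is the multinomial coefficient of the multiplicities other than [t j]. *)
Lemma bin_dvdn_multinomial (m : nat) (t : {ffun 'I_m -> nat}) (j : 'I_m) :
  'C(\sum_i t i, t j) %| multinomial t.
Proof.
rewrite /multinomial (bigD1 j) //= [X in _ %/ X](bigD1 j) //=.
set s := \sum_(i | i != j) t i; set P := \prod_(i | i != j) (t i)`!.
have /dvdnP[c cE] : P %| s`! by exact: dvdn_fact_sum.
have P0 : 0 < P by rewrite prodn_gt0 // => i; exact: fact_gt0.
apply/dvdnP; exists c; rewrite -(bin_fact (leq_addr s (t j))) addKn cE.
rewrite !mulnA [X in X %/ _](_ : _ = c * 'C(t j + s, t j) * ((t j)`! * P)); last by nia.
by rewrite mulnK // muln_gt0 fact_gt0.
Qed.

Lemma multinomial_prime_power (m p r : nat) (t : {ffun 'I_m -> nat}) :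
  prime p -> 2 < p ^ r -> multinomial t = p ^ r ->
  exists i j, i != j /\ t = two_part (p ^ r) i j.
Proof.
move=> pp q2 E.
(* If every multiplicity is at most 1, the coefficient is the factorial of their sum: at most 2 when
   the sum is at most 2, and otherwise divisible by both 2 and 3, hence no prime power. *)
have [/forallP t1|] := boolP [forall j, t j <= 1].
  move: E; rewrite /multinomial [X in _ %/ X]big1 => [|i _]; last first.
    by case: (t i) (t1 i) => [|[|]].
  rewrite divn1; case: (\sum_i t i) => [|[|[|s]]] E; rewrite -?E // in q2.
  have dv k : 0 < k <= 3 -> k %| p ^ r.
    by case/andP=> k0 k3; rewrite -E dvdn_fact // k0 (leq_trans k3).
  have := dv 2 isT; have := dv 3 isT.
  by rewrite !Euclid_dvdX // !dvdn_prime2 // => /andP[/eqP <- _].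
rewrite negb_forall => /existsP[j]; rewrite -ltnNge => tj.
have := bin_dvdn_multinomial t j; rewrite E => /(dvdn_pfactor _ _ pp)[e _ Ee].
have Es : \sum_i t i = t j + \sum_(i | i != j) t i by rewrite (bigD1 j).
(* If [t j] is the only nonzero multiplicity, the coefficient is 1, which is too small. *)
have [s0|s0] := posnP (\sum_(i | i != j) t i).
  have Z i : i != j -> t i = 0.
    by move=> ij; move/eqP: s0; rewrite sum_nat_eq0 => /forall_inP/(_ i ij)/eqP.
  move: E; rewrite /multinomial Es s0 addn0 (bigD1 j) //= big1.
    by rewrite muln1 divnn fact_gt0 /=; lia.
  by move=> i ij; rewrite Z.
have [||tj1|tj1] := bin_prime_power pp _ _ Ee; [lia | lia | lia |].
have /eqP/sum_nat_eq1[i [ij ti Z]] : \sum_(i | i != j) t i = 1 by lia.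
exists i, j; split => //.
(* The value [t j] = [p ^ r] - 1 is not known yet: it follows by computing the coefficient of this
   tuple, which is [(t j).+1]. *)
suff Et : t = two_part (t j).+1 i j.
  by rewrite [LHS]Et -E [in RHS]Et multinomial_two_part.
apply/ffunP => k; rewrite ffunE; case: eqP => [->//|/eqP ki].
by case: eqP => [->//|/eqP kj]; rewrite Z.
Qed.

(** * Counting by pairs of distinct odd parts *)

Lemma Q_prime_power_ord (p r n : nat) : prime p -> 2 < p ^ r ->
  Q (p ^ r) n = \sum_(i < uphalf n) \sum_(j < uphalf n)
    ((i != j) && (2 * i + 1 + (p ^ r).-1 * (2 * j + 1) == n)).
Proof.
move=> pp q2; set q := p ^ r; rewrite /Q.
pose D := [pred u : 'I_(uphalf n) * 'I_(uphalf n) |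
  (u.1 != u.2) && (2 * u.1 + 1 + q.-1 * (2 * u.2 + 1) == n)].
have -> : fset_set (odd_partitions_multinomial q n) =
    [fset two_part q u.1 u.2 | u in D]%fset.
  apply/fsetP => t; rewrite in_fset_set; last exact: finite_odd_partitions_multinomial.
  apply/idP/imfsetP => /=.
    rewrite inE => -[tn tq].
    have [i [j [ij tE]]] := multinomial_prime_power pp q2 tq.
    exists (i, j) => //=; rewrite inE /= ij /=; apply/eqP; rewrite -[RHS]tn tE.
    rewrite (@big_two_part _ _ addn _ _ _ _ (fun (k : 'I__) a => (2 * k + 1) * a)) //=.
      by rewrite muln1 [q.-1 * _]mulnC.
    by move=> k; rewrite muln0.
  move=> [[i j]] /andP[/= ij /eqP En] ->; apply: mem_set; split; last first.
    by rewrite multinomial_two_part //; lia.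
  rewrite (@big_two_part _ _ addn _ _ _ _ (fun (k : 'I__) a => (2 * k + 1) * a)) //=.
    by rewrite muln1 [_ * q.-1]mulnC.
  by move=> k; rewrite muln0.
rewrite card_in_imfset /=; last first.
  move=> [i j] [i' j'] /andP[ij _] /andP[ij' _].
  exact: two_part_inj.
rewrite pair_bigA /= (eq_bigr (fun u => if D u then 1 else 0)) => [|u _]; last first.
  by rewrite /=; case: (_ && _).
rewrite -big_mkcond sum1_card.
exact/esym/cardE.
Qed.

(** An index range independent of [n] allows the sums over [n] and over pairs to be exchanged later.
    An index at least [uphalf n] stands for a part larger than [n], so the new terms are zero. *)
Lemma Q_prime_power (p r n N : nat) : prime p -> 2 < p ^ r -> n <= N ->
  Q (p ^ r) n = \sum_(0 <= i < N) \sum_(0 <= j < N)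
    ((i != j) && (2 * i + 1 + (p ^ r).-1 * (2 * j + 1) == n)).
Proof.
move=> pp q2 nN; have un : uphalf n <= N by lia.
rewrite Q_prime_power_ord // -(@big_nat_stable _ _ addn 0 (uphalf n) N) //=.
  rewrite big_mkord; apply: eq_bigr => i _.
  rewrite -(@big_nat_stable _ _ addn 0 (uphalf n) N) ?big_mkord //= => j nj.
  by rewrite [X in _ && X](_ : _ = false) ?andbF //; apply/negbTE; nia.
move=> i ni; rewrite big1 // => j _.
by rewrite [X in _ && X](_ : _ = false) ?andbF //; apply/negbTE; nia.
Qed.

(** * Decay of the dominating sequence *)

Local Open Scope classical_set_scope.
Local Open Scope ring_scope.

(** Each of the first [n] terms of the geometric series is at least [t ^+ n]. *)
Lemma natmul_expr_le (R : realType) (t : R) (n : nat) : 0 <= t < 1 ->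
  n%:R * t ^+ n <= (1 - t)^-1.
Proof.
move=> /andP[t0 t1]; have t1' : 0 < 1 - t by rewrite subr_gt0.
apply: (@le_trans _ _ (\sum_(i < n) t ^+ i)).
  rewrite mulr_natl -[X in _ *+ X]card_ord -sumr_const.
  by apply: ler_sum => i _; rewrite ler_wiXn2l ?(ltW t1) // ltnW.
rewrite -(ler_pM2l t1') mulfV ?gt_eqF // -[1 - t]opprB mulNr -subrX1 opprB.
by rewrite gerBl exprn_ge0.
Qed.

Lemma cvg_sqr_expr (R : realType) (y : R) : 0 <= y < 1 ->
  (fun n : nat => (n ^ 2)%:R * y ^+ n) @ \oo --> (0 : R).
Proof.
(* With [t] the fourth root of [y], n^2 y^n = (n t^n)^2 (t^2)^n is a bounded factor times a
   geometric one. *)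
move=> /andP[y0 y1]; pose t := Num.sqrt (Num.sqrt y).
have t0 : 0 <= t by exact: sqrtr_ge0.
have yE : y = t ^+ 4 by rewrite (exprM t 2 2) !sqr_sqrtr ?sqrtr_ge0.
have t1 : t < 1 by rewrite -(@expr_lt1 _ 4) // -yE.
have c0 : 0 <= (1 - t)^-1 by rewrite invr_ge0 subr_ge0 ltW.
pose c := (1 - t)^-1 ^+ 2.
apply: (@squeeze_cvgr _ _ _ _ (fun=> 0) (geometric c (t ^+ 2))).
- near=> n; rewrite mulr_ge0 ?exprn_ge0 //= natrX.
  have -> : n%:R ^+ 2 * y ^+ n = (n%:R * t ^+ n) ^+ 2 * (t ^+ 2) ^+ n.
    by rewrite yE [in RHS]exprMn -!exprM -[RHS]mulrA -exprD; congr (_ * _ ^+ _); lia.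
  rewrite ler_wpM2r ?exprn_ge0 // ler_pXn2r ?nnegrE ?mulr_ge0 ?exprn_ge0 //.
  by apply: natmul_expr_le; rewrite t0.
- exact: cvg_cst.
- by apply: cvg_geometric; rewrite ger0_norm ?exprn_ge0 // exprn_ilt1.
Unshelve. all: by end_near. Qed.

(* Absolute values in [R[i]] are themselves complex numbers, so the real limit
   has to be transported along [%:C]. *)
Lemma cvg_sqr_norm_expr (R : realType) (x : R[i]^o) : `|x| < 1 ->
  (fun n : nat => (n ^ 2)%:R * `|x| ^+ n : R[i]^o) @ \oo --> (0 : R[i]^o).
Proof.
move=> x1.
have [y yE] : exists y : R, `|x| = (y%:C)%C by apply/complex_realP; exact: normr_real.
have /andP y01 : 0 <= y /\ y < 1.
  by rewrite -ler0c -yE normr_ge0; split => //; rewrite -ltcR -yE.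
apply/cvgr0Pnorm_lt => e e0.
have [e' eE] : exists e' : R, e = (e'%:C)%C.
  by apply/complex_realP; rewrite realE ltW.
have /cvgr0Pnorm_lt/(_ e') := cvg_sqr_expr y01.
rewrite eE ltcR in e0 *; move=> /(_ e0); apply: filterS => n.
rewrite yE -rmorphXn -(rmorph_nat (real_complex R)) -rmorphM /=.
rewrite ger0_norm ?mulr_ge0 ?exprn_ge0 ?(andP y01).1 // => h.
rewrite ger0_norm ?ler0c ?mulr_ge0 ?exprn_ge0 ?(andP y01).1 //.
by rewrite ltcR.
Qed.

(* The bound is a hypothesis because [K] need not be archimedean. *)
Lemma cvg0_dominated (K : numFieldType) (x : K) (u : nat -> K) :
  (fun n : nat => (n ^ 2)%:R * `|x| ^+ n) @ \oo --> (0 : K) ->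
  (forall n, (0 < n)%N -> `|u n| <= (n ^ 2)%:R * `|x| ^+ n) -> u @ \oo --> (0 : K).
Proof.
move=> xdom ule; apply/cvgr0Pnorm_lt => e e0.
move/cvgr0Pnorm_lt: xdom => /(_ e e0) xe; near=> n.
apply: le_lt_trans (ule n _) _; first by near: n; exact: nbhs_infty_gt.
rewrite -[ltLHS]ger0_norm ?mulr_ge0 ?exprn_ge0 //; near: n; exact: xe.
Unshelve. all: by end_near. Qed.

(** * Convergence of the generating function *)

Lemma subr1X_neq0 (K : numFieldType) (x : K) (d : nat) :
  `|x| < 1 -> (0 < d)%N -> 1 - x ^+ d != 0.
Proof.
move=> x1 d0; rewrite subr_eq0; apply/eqP => /(congr1 Num.norm) /eqP.
by rewrite normr1 normrX eq_sym lt_eqF // exprn_ilt1 // -lt0n.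
Qed.

Lemma cvg_sum_geometric (K : numFieldType) (x : K) (a d : nat) :
  `|x| < 1 -> (fun n : nat => (n ^ 2)%:R * `|x| ^+ n) @ \oo --> (0 : K) ->
  (0 < d)%N ->
  (fun N : nat => \sum_(0 <= i < N) x ^+ (a + d * i)) @ \oo --> x ^+ a / (1 - x ^+ d).
Proof.
move=> x1 xdom d0.
have -> : (fun N : nat => \sum_(0 <= i < N) x ^+ (a + d * i)) =
    (fun N => x ^+ a / (1 - x ^+ d) * (1 - (x ^+ d) ^+ N)).
  apply/funext => N; rewrite big_mkord.
  rewrite -[1 - (x ^+ d) ^+ N]opprB subrX1 -mulNr opprB mulrA divfK ?subr1X_neq0 //.
  by rewrite mulr_sumr; apply: eq_bigr => i _; rewrite exprD exprM.
rewrite -[X in _ --> X]mulr1; apply: cvgMl_tmp.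
rewrite -[X in _ --> X]subr0; apply: cvgB; first exact: cvg_cst.
(* The remainder is at most |x|^n, hence at most the cruder n^2 |x|^n, whose convergence is
   assumed. *)
apply: (cvg0_dominated xdom) => n n0; rewrite -exprM normrX.
rewrite -[leLHS]mul1r ler_pM ?exprn_ge0 ?ler1n ?expn_gt0 ?n0 //.
by rewrite ler_wiXn2l ?(ltW x1) // leq_pmull.
Qed.

Lemma cvg_odd_pairs (K : numFieldType) (x : K) (q : nat) :
  `|x| < 1 -> (fun n : nat => (n ^ 2)%:R * `|x| ^+ n) @ \oo --> (0 : K) ->
  (1 < q)%N ->
  (fun N : nat => \sum_(0 <= i < N) \sum_(0 <= j < N)
     ((i != j) && (2 * i + 1 + q.-1 * (2 * j + 1) < N)%N)%:R *
       x ^+ (2 * i + 1 + q.-1 * (2 * j + 1))) @ \oo -->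
  x ^+ q / ((1 - x ^+ 2) * (1 - x ^+ (2 * (q - 1)))) - x ^+ q / (1 - x ^+ (2 * q)).
Proof.
move=> x1 xdom q1; pose f i j := (2 * i + 1 + q.-1 * (2 * j + 1))%N.
(* [G] runs over u = 2i + 1, [H] over (q - 1)v with v = 2j + 1, and [D] over the diagonal, where the
   exponent is q(2i + 1). *)
pose G N := \sum_(0 <= i < N) x ^+ (1 + 2 * i).
pose H N := \sum_(0 <= j < N) x ^+ (q.-1 + 2 * (q - 1) * j).
pose D N := \sum_(0 <= i < N) x ^+ (q + 2 * q * i).
apply: (@cvg_sub0 _ _ _ _ _ _ ((G \* H) - D)); last first.
  have -> : x ^+ q / ((1 - x ^+ 2) * (1 - x ^+ (2 * (q - 1)))) =
      x ^+ 1 / (1 - x ^+ 2) * (x ^+ q.-1 / (1 - x ^+ (2 * (q - 1)))).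
    by rewrite mulf_div -exprD add1n prednK // ltnW.
  by apply: cvgB; [apply: cvgM|]; apply: cvg_sum_geometric => //; lia.
(* The terms lost by truncating the square number at most [N ^ 2], each of
   exponent at least [N]. *)
apply: (cvg0_dominated xdom) => N N0.
have -> : (((fun N : nat => \sum_(0 <= i < N) \sum_(0 <= j < N)
     ((i != j) && (f i j < N)%N)%:R * x ^+ f i j) : nat -> K) - (G \* H - D)) N =
   - \sum_(0 <= i < N) \sum_(0 <= j < N) ((i != j) && (N <= f i j)%N)%:R * x ^+ f i j.
  have GH : G N * H N = \sum_(0 <= i < N) \sum_(0 <= j < N) x ^+ f i j.
    rewrite mulr_suml; apply: eq_bigr => i _; rewrite mulr_sumr; apply: eq_bigr => j _.
    by rewrite -exprD; congr (_ ^+ _); rewrite /f -subn1; nia.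
  have DD : D N = \sum_(0 <= i < N) \sum_(0 <= j < N) (i == j)%:R * x ^+ f i j.
    rewrite /D !big_mkord; apply: eq_bigr => i _.
    rewrite big_mkord (bigD1 i) //= eqxx mul1r.
    rewrite big1 ?addr0 => [|j ji]; last first.
      by move: ji; rewrite -val_eqE eq_sym => /negPf ->; rewrite mul0r.
    by congr (_ ^+ _); rewrite /f -subn1; nia.
  rewrite !fctE /= GH DD -!sumrB -sumrN; apply: eq_bigr => i _.
  rewrite -!sumrB -sumrN; apply: eq_bigr => j _.
  (* [D] cancels the whole diagonal of the square, so only off-diagonal pairs with exponent at least
     [N] survive. *)
  by rewrite [(N <= _)%N]leqNgt; case: (i == j); case: (_ < N)%N; rewrite /=; ring.
rewrite normrN; apply: le_trans (ler_norm_sum _ _ _) _.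
rewrite natrX expr2 -mulrA -[X in X%:R * _]subn0 mulr_natl -sumr_const_nat.
apply: ler_sum => i _; apply: le_trans (ler_norm_sum _ _ _) _.
rewrite -[X in X%:R * _]subn0 mulr_natl -sumr_const_nat; apply: ler_sum => j _.
case: andP => [[_ Nf]|_]; last by rewrite mul0r normr0 exprn_ge0.
by rewrite mul1r normrX ler_wiXn2l // ltW.
Qed.

Lemma cvg_sum_Q (K : numFieldType) (x : K) (p r : nat) :
  `|x| < 1 -> (fun n : nat => (n ^ 2)%:R * `|x| ^+ n) @ \oo --> (0 : K) ->
  prime p -> (2 < p ^ r)%N ->
  (fun N : nat => \sum_(1 <= n < N) (Q (p ^ r) n)%:R * x ^+ n) @ \oo -->
    x ^+ (p ^ r) / ((1 - x ^+ 2) * (1 - x ^+ (2 * (p ^ r - 1))))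
    - x ^+ (p ^ r) / (1 - x ^+ (2 * p ^ r)).
Proof.
move=> x1 xdom pp q2; set q := (p ^ r)%N.
under eq_fun => N.
  have -> : \sum_(1 <= n < N) (Q q n)%:R * x ^+ n =
    \sum_(0 <= i < N) \sum_(0 <= j < N)
     ((i != j) && (2 * i + 1 + q.-1 * (2 * j + 1) < N)%N)%:R *
       x ^+ (2 * i + 1 + q.-1 * (2 * j + 1)); last over.
  under eq_big_nat => n /andP[_ nN].
    rewrite (Q_prime_power pp q2 (ltnW nN)) natr_sum mulr_suml.
    under eq_bigr do rewrite natr_sum mulr_suml.
    over.
  (* For a fixed pair with [i != j], only [n = m] can contribute; as [m] is positive, it is in the
     range exactly when [m < N]. *)
  rewrite exchange_big /=; apply: eq_bigr => i _.
  rewrite exchange_big /=; apply: eq_bigr => j _.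
  rewrite -/q; set m := (2 * i + 1 + q.-1 * (2 * j + 1))%N.
  have m0 : (0 < m)%N by rewrite /m addn1.
  have [ij|ij] := boolP (i != j); last by rewrite mul0r big1 // => n _; rewrite mul0r.
  rewrite /=; have [mN|mN] := ltnP m N.
    rewrite mul1r (bigD1_seq m) ?iota_uniq ?mem_index_iota ?m0 //=.
    rewrite eqxx mul1r big1 ?addr0 // => n nm.
    by rewrite eq_sym (negPf nm) mul0r.
  rewrite mul0r big_nat big1 // => n /andP[_ nN].
  by rewrite gtn_eqF ?mul0r // (leq_trans nN).
by apply: cvg_odd_pairs => //; lia.
Qed.

Theorem theorem2 (R : realType) (p r : nat) (x : R[i]^o)
    (hp : prime p) (hr : (0 < r)%N) (hpr : (2 < p ^ r)%N) (hx : `|x| < 1) :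
  (fun N : nat => \sum_(1 <= n < N) (Q (p ^ r) n)%:R * x ^+ n) @ \oo -->
    x ^+ (p ^ r) / ((1 - x ^+ 2) * (1 - x ^+ (2 * (p ^ r - 1))))
    - x ^+ (p ^ r) / (1 - x ^+ (2 * p ^ r)).
Proof.
exact: (cvg_sum_Q hx (cvg_sqr_norm_expr hx) hp hpr).
Qed.
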